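(* Let $(X,\mathscr U)$ be a separated uniform space endowed with a graph $G$, let $p$ be an $E$-distance on $X$, and let $T:X\to X$ be an integral type $p$-$\widetilde G$-contraction. If the subgraph of $G$ with vertex set $\mathrm{Fix}(T)$ is weakly connected, then $T$ has at most one fixed point in $X$.
   Context: A uniform space is a nonempty set $X$ with a uniformity $\mathscr U$; it is separated if the intersection of all members of $\mathscr U$ is the diagonal $\Delta(X)=\{(x,x):x\in X\}$. A function $p:X\times X\to[0,+\infty)$ is an $E$-distance on $X$ if (i) for each $V\in\mathscr U$ there is $\delta>0$ such that for all $x,y,z\in X$, $p(z,x)\le\delta$ and $p(z,y)\le\delta$ imply $(x,y)\in V$; and (ii) $p(x,y)\le p(x,z)+p(z,y)$ for all $x,y,z\in X$. (No symmetry of $p$ and no condition $p(x,x)=0$ is assumed.) A graph $G$ on $X$ is a directed graph without parallel edges with vertex set $V(G)=X$ and edge set $E(G)\subseteq X\times X$ containing all loops, i.e. $E(G)\supseteq\Delta(X)$. For a directed graph $H$, $\widetilde H$ is the graph with the same vertices and $E(\widetilde H)=\{(x,y): (x,y)\in E(H)\text{ or }(y,x)\in E(H)\}$. A path in a graph $H$ from $x$ to $y$ is a finite sequence $(x_i)_{i=0}^N$ of vertices of $H$ with $x_0=x$, $x_N=y$ and $(x_{i-1},x_i)\in E(H)$ for $i=1,\dots,N$. $H$ is weakly connected if there is a path in $\widetilde H$ between each two of its vertices. $\mathrm{Fix}(T)$ is the set of fixed points of $T$; the subgraph of $G$ with vertex set $\mathrm{Fix}(T)$ has edge set $E(G)\cap(\mathrm{Fix}(T)\times\mathrm{Fix}(T))$.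 $\Phi$ is the class of functions $\varphi:[0,+\infty)\to[0,+\infty)$ that are Lebesgue-integrable on $[0,+\infty)$, in the sense that $\varphi$ is Lebesgue measurable and the value of the integral over $[0,+\infty)$ is allowed to be $+\infty$, and such that $\int_0^\varepsilon\varphi(t)\,dt$ is positive and finite for every $\varepsilon>0$. $T:X\to X$ is an integral type $p$-$\widetilde G$-contraction if (IC1) $(x,y)\in E(\widetilde G)$ implies $(Tx,Ty)\in E(\widetilde G)$; and (IC2) there exist $\varphi\in\Phi$ and $\alpha\in(0,1)$ such that $\int_0^{p(Tx,Ty)}\varphi(t)\,dt\le\alpha\int_0^{p(x,y)}\varphi(t)\,dt$ for all $x,y\in X$ with $(x,y)\in E(\widetilde G)$. *)

(* Defs.v *)
From HB Require Import structures.
From mathcomp Require Import all_boot all_order all_algebra.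
From mathcomp Require Import all_classical all_reals all_analysis.

Set Implicit Arguments.
Unset Strict Implicit.
Unset Printing Implicit Defensive.

Import Order.TTheory GRing.Theory Num.Theory.

Local Open Scope classical_set_scope.
Local Open Scope ring_scope.

(* [uniformType] does not require an inhabitant, so nonemptiness is a separate
   hypothesis wherever it is wanted. *)
Definition separated_uniformity (X : uniformType) : Prop :=
  \bigcap_(V in @entourage X) V = diagonal.

Definition E_distance (R : realType) (X : uniformType) (p : X -> X -> R) :
  Prop :=
  [/\ forall x y, 0 <= p x y,
      forall V : set (X * X), entourage V ->
        exists2 delta : R, 0 < delta &
          forall x y z, p z x <= delta -> p z y <= delta -> V (x, y) &
      forall x y z, p x y <= p x z + p z y].

(* The vertex set is a component so that proper subgraphs live on the same
   carrier as the ambient graph; no parallel edges, since edges form a set. *)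
Record digraph (X : Type) := Digraph {
  vertices : set X;
  edges : set (X * X);
  edges_vertices : edges `<=` vertices `*` vertices }.

Definition graph_on (X : Type) (G : digraph X) : Prop :=
  vertices G = [set: X] /\ diagonal `<=` edges G.

Section Graphs.
Context {X : Type}.
Implicit Types (H : digraph X) (A : set X).

Definition sym_edges H : set (X * X) :=
  [set e | edges H e \/ edges H (e.2, e.1)].

Lemma sym_edges_vertices H : sym_edges H `<=` vertices H `*` vertices H.
Proof. by move=> [x y] [] /edges_vertices [] /=. Qed.

Definition undirected H : digraph X := Digraph (@sym_edges_vertices H).

Definition induced_edges H A : set (X * X) := edges H `&` (A `*` A).

Lemma induced_edges_vertices H A :
  induced_edges H A `<=` (vertices H `&` A) `*` (vertices H `&` A).
Proof. by move=> [x y] [] /edges_vertices [] /= ? ? [] /= ? ?. Qed.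

Definition induced_subgraph H A : digraph X :=
  Digraph (@induced_edges_vertices H A).

(* Only the values u 0, ..., u N matter. *)
Definition path_between H (x y : X) : Prop :=
  exists (N : nat) (u : nat -> X),
    [/\ u 0%N = x, u N = y,
        forall i, (i <= N)%N -> vertices H (u i) &
        forall i, (i < N)%N -> edges H (u i, u i.+1)].

Definition weakly_connected H : Prop :=
  forall x y, vertices H x -> vertices H y -> path_between (undirected H) x y.

End Graphs.

Definition Fix (X : Type) (T : X -> X) : set X := [set x | T x = x].

(* The carrier of the completed Lebesgue measure: the real line with the
   Lebesgue (Caratheodory-measurable), not merely Borel, sigma-algebra. *)
Definition lebesgueR (R : realType) := caratheodory_type (@wlength R idfun)^*%mu.

(* Functions on [0, +oo[ are represented by functions on the line, of which only
   the values on [0, +oo[ are constrained or used. *)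
Definition integral_upto (R : realType) (phi : R -> R) (a : R) : \bar R :=
  (\int[@completed_lebesgue_measure R]_(t in (`[0%R, a] : set (lebesgueR R)))
     (phi t)%:E)%E.

Definition class_Phi (R : realType) (phi : R -> R) : Prop :=
  [/\ forall t, 0 <= t -> 0 <= phi t,
      measurable_fun (`[0, +oo[ : set (lebesgueR R)) (phi : lebesgueR R -> R) &
      forall eps, 0 < eps -> (0 < integral_upto phi eps < +oo)%E].

Definition integral_contraction (R : realType) (X : Type) (p : X -> X -> R)
    (H : digraph X) (T : X -> X) : Prop :=
  (forall x y, edges H (x, y) -> edges H (T x, T y)) /\
  exists (phi : R -> R) (alpha : R),
    [/\ class_Phi phi, 0 < alpha < 1 &
        forall x y, edges H (x, y) ->
          (integral_upto phi (p (T x) (T y))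
             <= alpha%:E * integral_upto phi (p x y))%E].

(* Main.v *)
(* The contraction inequality forces [p] to vanish on every edge joining two
   fixed points, since otherwise its integral is a positive finite number that
   is at most [alpha] times itself. The loops give [p x x = 0], and the triangle
   inequality along a path of fixed points gives [p x y = 0]; these two
   equalities put [(x, y)] in every entourage. *)
Require Import Defs.
From mathcomp Require Import all_boot all_order all_algebra.
From mathcomp Require Import all_classical all_reals all_analysis.
Import Order.TTheory GRing.Theory Num.Theory.
Local Open Scope classical_set_scope.
Local Open Scope ring_scope.

(** Strictness needs both bounds on [I]: at [0], and at [+oo] when [a] is positive, the two sides
    agree. *)
Lemma lte_scale_lt1 (R : realType) (a : R) (I : \bar R) :
  a < 1 -> (0 < I < +oo)%E -> (a%:E * I < I)%E.
Proof.
move=> a1; case: I => [r| |] /andP[] // r0 _.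
by rewrite -EFinM lte_fin -ltr_pdivlMr ?divff ?gt_eqF -?lte_fin.
Qed.

Lemma contraction_fixed_edge (R : realType) (X : Type) (p : X -> X -> R)
    (H : digraph X) (T : X -> X) (x y : X) :
  (forall a b, 0 <= p a b) -> integral_contraction p H T ->
  Fix T x -> Fix T y -> edges H (x, y) -> p x y = 0.
Proof.
move=> p0 [_ [phi [alpha [[_ _ phiI] /andP[_ alpha1] contr]]]] Tx Ty xy.
apply/eqP/negP => /negP pN0.
have := contr _ _ xy; rewrite Tx Ty leNgt => /negP; apply.
by apply: lte_scale_lt1 => //; apply: phiI; rewrite lt_neqAle eq_sym pN0 p0.
Qed.

Lemma E_distance_separated (R : realType) (X : uniformType) (p : X -> X -> R)
    (z x y : X) :
  separated_uniformity X -> E_distance p -> p z x = 0 -> p z y = 0 -> x = y.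
Proof.
move=> sepX [_ pV _] pzx pzy.
suff : diagonal (x, y) by [].
by rewrite -sepX => V /pV[d /ltW d0 dV]; apply: (dV _ _ z); rewrite ?pzx ?pzy.
Qed.

Theorem theorem3 (R : realType) (X : uniformType) (G : digraph X)
    (p : X -> X -> R) (T : X -> X) :
  [set: X] !=set0 ->
  separated_uniformity X ->
  graph_on G ->
  E_distance p ->
  integral_contraction p (undirected G) T ->
  weakly_connected (induced_subgraph G (Fix T)) ->
  forall x y : X, Fix T x -> Fix T y -> x = y.
Proof.
move=> _ sepX [GT loops] Ep contr conn x y Tx Ty.
have [p0 _ tri] := Ep.
have edge0 a b : Fix T a -> Fix T b -> edges (undirected G) (a, b) -> p a b = 0.
  exact: contraction_fixed_edge.
have pxx : p x x = 0 by apply: edge0 => //; left; apply: loops.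
have [||N [u [u0 uN _ uE]]] := conn x y; [by rewrite /= GT..|].
have pxu i : (i <= N)%N -> p x (u i) = 0.
  elim: i => [|i IH] iN; first by rewrite u0.
  have puu : p (u i) (u i.+1) = 0.
    (* Whichever way the edge of the induced subgraph points, it is an edge of [undirected G] with
       both ends fixed. *)
    by case: (uE i iN) => -[Gu [Tu Tv]]; apply: edge0 => //; [left|right].
  apply/eqP; rewrite eq_le p0 andbT.
  by rewrite (le_trans (tri _ _ (u i))) // IH ?(ltnW iN) // puu addr0.
(* The entourage condition compares two distances from one base point; taking [x] itself as base is
   what calls for [pxx]. *)
by apply: (@E_distance_separated _ _ p x) => //; rewrite -uN pxu.
Qed.
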